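(* For all $b\ge1$, $\rho\in(0,1]$ and integers $\Delta\ge 0$, $q\ge1$ there exists $\alpha=\alpha_{b,\rho,\Delta,q}>0$ such that the following is true. Let $n\ge1$, let $\Sigma$ be a finite set with $|\Sigma|=q$, and let $\nu$ be a probability measure on $\Sigma^n$ such that: (1) $\nu(x)/\nu(y)\in[1/b,b]$ for all $x,y\in\Sigma^n$ at Hamming distance one; (2) the Glauber dynamics for $\nu$ satisfy the log-Sobolev inequality with constant $\rho$; (3) $\nu$ is a Markov random field with respect to a graph $G$ on $[n]$ of maximum degree $\Delta$. Then for every $f:\Sigma^n\to\{0,1\}$ there exists a coordinate $k\in[n]$ such that $$I_k(f)\ge \alpha\,\mathrm{Var}_\nu(f)\,\frac{\log n}{n}.$$
   Context: The influence of coordinate $i$ on $f:\Sigma^n\to\{0,1\}$ is $I_i(f)=\Pr_{X\sim\nu}[\exists x_i'\in\Sigma:\ f(X)\ne f(X_1,\dots,X_{i-1},x_i',X_{i+1},\dots,X_n)]$. For $x\in\Sigma^n$, $x_{\sim i}$ denotes $x$ with coordinate $i$ removed. For $i\in[n]$, $(P_if)(x)=\mathbb{E}_{X\sim\nu}[f(X)\mid X_{\sim i}=x_{\sim i}]$ and $L_if=P_if-f$. The Dirichlet form of the (continuous-time) Glauber dynamics is $\mathcal{E}_\nu(f,f)=\sum_{i=1}^n\mathbb{E}_\nu[(L_if)^2]$. The Glauber dynamics for $\nu$ satisfy the log-Sobolev inequality with constant $\rho>0$ if $\rho\,\mathrm{Ent}_\nu[f]\le 2\mathcal{E}_\nu(\sqrt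 f,\sqrt f)$ for all $f:\Sigma^n\to\mathbb{R}_{\ge0}$, where $\mathrm{Ent}_\nu[f]=\mathbb{E}_\nu[f\log f]-\mathbb{E}_\nu[f]\log\mathbb{E}_\nu[f]$. $\nu$ is a Markov random field with respect to $G$ if for every vertex $i$ with neighbor set $\mathcal{N}(i)$ and $X\sim\nu$, $X_i$ is conditionally independent of all the other coordinates given $X_{\mathcal{N}(i)}$. *)

(* Defs.v *)
From HB Require Import structures.
From mathcomp Require Import all_boot all_order all_algebra.
From mathcomp Require Import reals exp.

Set Implicit Arguments.
Unset Strict Implicit.
Unset Printing Implicit Defensive.

Import Order.TTheory GRing.Theory Num.Theory.
Local Open Scope ring_scope.

Section FiniteProbability.
Context {R : realType} {T : finType}.
Implicit Types (nu f : T -> R) (A B : pred T).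

Definition is_pmf nu : Prop := (forall x, 0 <= nu x) /\ \sum_x nu x = 1.

Definition Pr nu A : R := \sum_(x | A x) nu x.

Definition Ex nu f : R := \sum_x nu x * f x.

Definition Var nu f : R := Ex nu (fun x => (f x - Ex nu f) ^+ 2).

(* [ln] is total, so 0 log 0 = 0. *)
Definition Ent nu f : R :=
  Ex nu (fun x => f x * ln (f x)) - Ex nu f * ln (Ex nu f).

(* Conditioning on a null event gives 0, because [x / 0 = 0]. *)
Definition cPr nu A B : R := Pr nu (predI A B) / Pr nu B.

Definition cEx nu f B : R := (\sum_(x | B x) nu x * f x) / Pr nu B.

(* No positivity condition on the event [W = w] is needed: when it is null,
   both sides are 0. *)
Definition cond_indep nu (TU TV TW : eqType)
    (U : T -> TU) (V : T -> TV) (W : T -> TW) : Prop :=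
  forall u v w,
    cPr nu [pred x | (U x == u) && (V x == v)] [pred x | W x == w] =
    cPr nu [pred x | U x == u] [pred x | W x == w] *
    cPr nu [pred x | V x == v] [pred x | W x == w].

End FiniteProbability.

Section ProductSpace.
Context {n : nat} {Sigma : finType}.
Implicit Types (x y : {ffun 'I_n -> Sigma}) (i : 'I_n).

Definition hamming x y : nat := #|[set i | x i != y i]|.

Definition update x i (a : Sigma) : {ffun 'I_n -> Sigma} :=
  [ffun j => if j == i then a else x j].

Definition restr (A : {set 'I_n}) x : {ffun {j : 'I_n | j \in A} -> Sigma} :=
  [ffun j => x (val j)].

End ProductSpace.

Section Glauber.
Context {R : realType} {n : nat} {Sigma : finType}.
Variable nu : {ffun 'I_n -> Sigma} -> R.
Implicit Types (i : 'I_n) (g : {ffun 'I_n -> Sigma} -> R).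

Definition influence i (f : {ffun 'I_n -> Sigma} -> bool) : R :=
  Pr nu [pred x | [exists a : Sigma, f x != f (update x i a)]].

Definition glauberP i g (x : {ffun 'I_n -> Sigma}) : R :=
  cEx nu g [pred y | restr [set~ i] y == restr [set~ i] x].

Definition glauberL i g (x : {ffun 'I_n -> Sigma}) : R :=
  glauberP i g x - g x.

(* The diagonal E_nu(g, g) of the Dirichlet form. *)
Definition dirichlet g : R :=
  \sum_(i < n) Ex nu (fun x => glauberL i g x ^+ 2).

Definition log_sobolev (rho : R) : Prop :=
  forall g, (forall x, 0 <= g x) ->
    rho * Ent nu g <= 2 * dirichlet (fun x => Num.sqrt (g x)).

Definition bounded_ratios (b : R) : Prop :=
  forall x y, hamming x y = 1%N -> b^-1 <= nu x / nu y <= b.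

End Glauber.

Section Graph.
Context {V : finType}.
Variable e : rel V.

Definition simple_graph : Prop := symmetric e /\ irreflexive e.

Definition neighbors (i : V) : {set V} := [set j | e i j].

Definition max_degree : nat := \max_(i : V) #|neighbors i|.

End Graph.

Definition markov_random_field {R : realType} {n : nat} {Sigma : finType}
    (nu : {ffun 'I_n -> Sigma} -> R) (e : rel 'I_n) : Prop :=
  forall i : 'I_n,
    cond_indep nu (fun x => x i) (restr (~: (i |: neighbors e i)))
      (restr (neighbors e i)).

(* Main.v *)
(** Let [P i] be the conditional expectation given all coordinates but [i],
    [D i = 1 - P i], [E f = sum_i |D i f|_2^2], and run the discrete Glauber
    dynamics [f_(k+1) = (1/n) sum_i P i f_k] for [n] steps. If all
    influences are at most [delta], then [|D i f_0|_1 <= delta], and since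
    [P i] and [P j] commute unless [i] and [j] are adjacent, [max_i |D i
    f_k|_1 <= exp (4 Delta) delta] for [k <= n]. Following Falik and
    Samorodnitsky, apply log-Sobolev to each [D i f_k]: as [Ent (h^2) >=
    |h|_2^2 ln (|h|_2^2 / |h|_1^2)], small L1 norms force [sum_(i,j) |D j D
    i f_k|_2^2], hence the energy dissipation [|sum_i D i f_k|_2^2], to be
    of order [rho ln n E(f_k)]. So [E(f_k)] decays at rate [ln n] per unit
    of time, and [Var f <= const * E(f_0) / ln n <= const * n delta / ln n],
    where the variance left after [n] steps is absorbed by the Poincare
    inequality. *)

Require Import Defs.
From HB Require Import structures.
From mathcomp Require Import all_boot all_order all_algebra.
From mathcomp Require Import reals sequences exp.
From mathcomp Require Import ring lra.

Set Implicit Arguments.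
Unset Strict Implicit.
Unset Printing Implicit Defensive.

Import Order.TTheory GRing.Theory Num.Theory.
Local Open Scope ring_scope.

(** From [1 + y <= expR y] at [y = x / m]. It turns a growth factor [1 + x / m] per step into a
    bound uniform in [m] over at most [m] steps. *)
Lemma expr_1Ddiv_le_expR {R : realType} (x : R) (m : nat) :
  (0 < m)%N -> 0 <= x ->
  forall k, (k <= m)%N -> (1 + m%:R^-1 * x) ^+ k <= expR x.
Proof.
move=> m0 x0 k km; have m0' : 0 < m%:R :> R by rewrite ltr0n.
apply: (@le_trans _ _ (expR (m%:R^-1 * x) ^+ k)).
  rewrite lerXn2r ?nnegrE ?expR_ge0 ?expR_ge1Dx //.
  by rewrite addr_ge0 // mulr_ge0 // invr_ge0 ltW.
rewrite -expRM_natl ler_expR mulrA ler_piMl // ler_pdivrMr // mul1r.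
by rewrite ler_nat.
Qed.

(** * Expectation, variance and lower bounds on entropy *)

Section Expectation.
Context {R : realType} {T : finType} (nu : T -> R).
Hypothesis nu_pmf : is_pmf nu.
Implicit Types f g h : T -> R.

Lemma eq_Ex f g : f =1 g -> Ex nu f = Ex nu g.
Proof. by move=> fg; apply: eq_bigr => x _; rewrite fg. Qed.

Lemma ExD f g : Ex nu (fun x => f x + g x) = Ex nu f + Ex nu g.
Proof. by rewrite -big_split; apply: eq_bigr => x _; rewrite mulrDr. Qed.

Lemma ExZ c f : Ex nu (fun x => c * f x) = c * Ex nu f.
Proof. by rewrite /Ex mulr_sumr; apply: eq_bigr => x _; rewrite mulrCA. Qed.

Lemma Ex_cst c : Ex nu (fun=> c) = c.
Proof. by rewrite /Ex -mulr_suml; case: nu_pmf => _ ->; rewrite mul1r. Qed.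

Lemma le_Ex f g : (forall x, f x <= g x) -> Ex nu f <= Ex nu g.
Proof.
move=> fg; apply: ler_sum => x _.
by apply: ler_wpM2l (fg x); case: nu_pmf => ->.
Qed.

Lemma Ex_ge0 f : (forall x, 0 <= f x) -> 0 <= Ex nu f.
Proof. by move=> f0; rewrite -[leLHS](Ex_cst 0); exact: le_Ex. Qed.

Lemma VarE f : Var nu f = Ex nu (fun x => f x ^+ 2) - Ex nu f ^+ 2.
Proof.
rewrite /Var; set m := Ex nu f.
have -> : Ex nu (fun x => (f x - m) ^+ 2) =
    Ex nu (fun x => f x ^+ 2 + ((- 2 * m) * f x + m ^+ 2)).
  by apply: eq_Ex => x; ring.
by rewrite ExD ExD ExZ Ex_cst -/m; ring.
Qed.

Lemma Var_ge0 f : 0 <= Var nu f.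
Proof. by apply: Ex_ge0 => x; exact: sqr_ge0. Qed.

Lemma Var_shift f c : Var nu (fun x => f x + c) = Var nu f.
Proof. by apply: eq_Ex => x; rewrite ExD Ex_cst; ring. Qed.

Lemma ln_le_subr1 (x : R) : 0 < x -> ln x <= x - 1.
Proof.
move=> x0; have := @le_ln1Dx R (x - 1); rewrite (addrC 1) subrK.
by apply; lra.
Qed.

Lemma Ex_eq0 f : (forall x, 0 <= f x) -> Ex nu f = 0 ->
  forall x, nu x * f x = 0.
Proof.
move=> f0 Ef0 x.
exact: (psumr_eq0P (fun x _ => mulr_ge0 (nu_pmf.1 x) (f0 x)) Ef0).
Qed.

Lemma Ex_norm_gt0 h :
  0 < Ex nu (fun x => h x ^+ 2) -> 0 < Ex nu (fun x => `|h x|).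
Proof.
move=> m0; rewrite lt_def Ex_ge0 // andbT; apply: contraTneq m0 => l0.
rewrite /Ex big1 ?ltxx // => x _.
have /eqP := Ex_eq0 (fun x => normr_ge0 (h x)) l0 x.
rewrite mulf_eq0 normr_eq0 => /orP[] /eqP ->; first by rewrite mul0r.
by rewrite expr0n mulr0.
Qed.

(* Gibbs' inequality against the density proportional to [|h|]. *)
Lemma Ent_sq_ge h : 0 < Ex nu (fun x => h x ^+ 2) ->
  Ex nu (fun x => h x ^+ 2) *
    ln (Ex nu (fun x => h x ^+ 2) / Ex nu (fun x => `|h x|) ^+ 2)
  <= Ent nu (fun x => h x ^+ 2).
Proof.
set m := Ex nu (fun x => h x ^+ 2); set l := Ex nu (fun x => `|h x|) => m0.
have l0 : 0 < l := Ex_norm_gt0 m0.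
set t := m / l; have t0 : 0 < t by rewrite divr_gt0.
(* The tangent bound [ln u <= u - 1] at [u = t / |h x|]. Since [t * l = m], the terms without
   logarithm cancel in expectation. *)
have key x : 2 * (ln t + 1) * h x ^+ 2 + (- 2 * t) * `|h x| <=
    h x ^+ 2 * ln (h x ^+ 2).
  have [->|hx] := eqVneq (h x) 0.
    by rewrite normr0 expr0n /= !(mulr0, mul0r) addr0.
  have a0 : 0 < `|h x| by rewrite normr_gt0.
  rewrite -(real_normK (num_real (h x))); move: (`|h x|) a0 => a a0.
  have lta : ln (t / a) = ln t - ln a by rewrite ln_div.
  have := ln_le_subr1 (divr_gt0 t0 a0); rewrite lta lnXn // => H.
  have H1 : a ^+ 2 * (ln t - ln a) <= a ^+ 2 * (t / a - 1).
    by rewrite ler_wpM2l // sqr_ge0.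
  have H2 : a ^+ 2 * (t / a - 1) = a * t - a ^+ 2 by field; exact: lt0r_neq0.
  rewrite H2 in H1; rewrite -[ln a *+ 2]mulr_natl.
  lra.
have := le_Ex key; rewrite ExD !ExZ -/m -/l => H.
have tl : t * l = m by rewrite /t divfK // lt0r_neq0.
have lnt : ln t = ln m - ln l by rewrite ln_div.
have -> : ln (m / l ^+ 2) = ln m - 2 * ln l.
  by rewrite ln_div ?posrE ?exprn_gt0 // lnXn // mulr_natl.
rewrite /Ent -/m; move: H.
have -> : 2 * (ln t + 1) * m + -2 * t * l = 2 * (ln m - ln l) * m.
  by rewrite lnt -tl; ring.
by move: (Ex _ _) => X; lra.
Qed.

(** For a positive second moment [m], this is [Ent_sq_ge] weakened by [ln u <= u - 1] at
    [u = l ^+ 2 / m]. It gives the nonnegativity of the entropy of a square and, later, the Poincare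
    inequality. *)
Lemma Var_norm_le_Ent_sq h :
  Var nu (fun x => `|h x|) <= Ent nu (fun x => h x ^+ 2).
Proof.
rewrite VarE (@eq_Ex _ (fun x => h x ^+ 2)); last first.
  by move=> x; rewrite real_normK ?num_real.
set m := Ex nu (fun x => h x ^+ 2); set l := Ex nu (fun x => `|h x|).
have m0 : 0 <= m by apply: Ex_ge0 => x; exact: sqr_ge0.
have l0 : 0 <= l by apply: Ex_ge0.
have [m00|mn0] := eqVneq m 0.
  have H := Ex_eq0 (fun x => sqr_ge0 (h x)) m00.
  rewrite /Ent -/m m00 mul0r subr0 sub0r /Ex big1 ?oppr_le0 ?sqr_ge0 //.
  by move=> x _; rewrite mulrA H mul0r.
have mp : 0 < m by rewrite lt_def mn0.
apply: le_trans (Ent_sq_ge mp); rewrite -/m -/l.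
have lp : 0 < l ^+ 2 by rewrite exprn_gt0 // Ex_norm_gt0.
have := ln_le_subr1 (divr_gt0 lp mp).
rewrite !ln_div ?posrE // => H.
have H1 : m * (ln (l ^+ 2) - ln m) <= m * (l ^+ 2 / m - 1) by rewrite ler_wpM2l.
have H2 : m * (l ^+ 2 / m - 1) = l ^+ 2 - m by field.
by rewrite H2 in H1; lra.
Qed.

(** Linearity in the second moment lets the bound be summed over coordinates. If the second moment
    is at most [s ^+ 2 * l ^+ 2], the left side is nonpositive; otherwise the logarithm in
    [Ent_sq_ge] is at least [2 * ln s]. *)
Lemma Ent_sq_ge_linear h s l : 1 <= s -> Ex nu (fun x => `|h x|) <= l ->
  2 * ln s * (Ex nu (fun x => h x ^+ 2) - s ^+ 2 * l ^+ 2)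
  <= Ent nu (fun x => h x ^+ 2).
Proof.
move=> s1 hl; set m := Ex _ _.
have s0 : 0 < s by lra.
have lns : 0 <= ln s by rewrite ln_ge0.
have l0 : 0 <= l by apply: le_trans hl; apply: Ex_ge0.
have [mle|mgt] := leP m (s ^+ 2 * l ^+ 2).
  apply: (@le_trans _ _ 0); first by rewrite mulr_ge0_le0 ?mulr_ge0 // subr_le0.
  by apply: le_trans (Var_norm_le_Ent_sq h); exact: Var_ge0.
have m0 : 0 < m by apply: le_lt_trans mgt; rewrite mulr_ge0 ?sqr_ge0.
set l' := Ex nu (fun x => `|h x|) in hl.
have l'0 : 0 <= l' by apply: Ex_ge0.
have l'l : l' ^+ 2 <= l ^+ 2 by rewrite lerXn2r.
have l'n0 : 0 < l' := Ex_norm_gt0 m0.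
apply: le_trans (Ent_sq_ge m0); rewrite -/m -/l'.
have : ln (s ^+ 2) <= ln (m / l' ^+ 2).
  rewrite ler_ln ?posrE ?divr_gt0 ?exprn_gt0 // ler_pdivlMr ?exprn_gt0 //.
  by apply: le_trans (ltW mgt); rewrite ler_wpM2l ?sqr_ge0.
rewrite lnXn // -[_ *+ 2]mulr_natl => H.
have H1 : m * (2 * ln s) <= m * ln (m / l' ^+ 2) by rewrite ler_wpM2l // ltW.
apply: le_trans H1; rewrite [leRHS]mulrC ler_wpM2l ?mulr_ge0 //.
by rewrite lerBlDr lerDl mulr_ge0 ?sqr_ge0.
Qed.

End Expectation.

(** * Inner product, L2 and L1 norms *)

Section InnerProduct.
Context {R : realType} {T : finType} (nu : T -> R).
Hypothesis nu_pmf : is_pmf nu.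
(* [R^o], not [R]: only the former makes this a left [R]-module. *)
Local Notation V := {ffun T -> R^o}.
Implicit Types (f g h : V) (c : R).

Definition dot f g : R := Ex nu (fun x => f x * g x).
Definition norm2 f : R := Ex nu (fun x => f x ^+ 2).
Definition norm1 f : R := Ex nu (fun x => `|f x|).

Lemma dotC f g : dot f g = dot g f.
Proof. by apply: eq_Ex => x; rewrite mulrC. Qed.

Lemma dot_is_linear f : linear_for *%R (dot f).
Proof.
move=> c g h; rewrite /dot -ExZ -ExD; apply: eq_Ex => x.
by rewrite !ffunE /GRing.scale /=; ring.
Qed.
HB.instance Definition _ f :=
  GRing.isLinear.Build R V R *%R (dot f) (dot_is_linear f).

Lemma dotDr f g h : dot f (g + h) = dot f g + dot f h.
Proof. exact: raddfD. Qed.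

Lemma dotBr f g h : dot f (g - h) = dot f g - dot f h.
Proof. exact: raddfB. Qed.

Lemma dotZr c f g : dot f (c *: g) = c * dot f g.
Proof. exact: linearZ. Qed.

Lemma dot_sumr (I : finType) (P : pred I) f (F : I -> V) :
  dot f (\sum_(i | P i) F i) = \sum_(i | P i) dot f (F i).
Proof. exact: raddf_sum. Qed.

Lemma dotDl f g h : dot (f + g) h = dot f h + dot g h.
Proof. by rewrite dotC dotDr !(dotC h). Qed.

Lemma dotBl f g h : dot (f - g) h = dot f h - dot g h.
Proof. by rewrite dotC dotBr !(dotC h). Qed.

Lemma dotZl c f g : dot (c *: f) g = c * dot f g.
Proof. by rewrite dotC dotZr dotC. Qed.

Lemma dot_suml (I : finType) (P : pred I) f (F : I -> V) :
  dot (\sum_(i | P i) F i) f = \sum_(i | P i) dot (F i) f.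
Proof. by rewrite dotC dot_sumr; apply: eq_bigr => i _; rewrite dotC. Qed.

Lemma norm2E f : norm2 f = dot f f. Proof. by []. Qed.

Lemma norm2_ge0 f : 0 <= norm2 f.
Proof. by apply: Ex_ge0 => // x; exact: sqr_ge0. Qed.

Lemma norm2Z c f : norm2 (c *: f) = c ^+ 2 * norm2 f.
Proof. by rewrite /norm2 -ExZ; apply: eq_Ex => x; rewrite !ffunE exprMn. Qed.

Lemma norm2D f g : norm2 (f + g) = norm2 f + 2 * dot f g + norm2 g.
Proof.
by rewrite !norm2E !(dotDl, dotDr) (dotC g f); ring.
Qed.

Lemma norm2B f g : norm2 (f - g) = norm2 f - 2 * dot f g + norm2 g.
Proof. by rewrite !norm2E !(dotBl, dotBr) (dotC g f); ring. Qed.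

Lemma norm1_ge0 f : 0 <= norm1 f.
Proof. exact: Ex_ge0. Qed.

Lemma norm1Z c f : norm1 (c *: f) = `|c| * norm1 f.
Proof. by rewrite /norm1 -ExZ; apply: eq_Ex => x; rewrite ffunE normrM. Qed.

Lemma ler_norm1D f g : norm1 (f + g) <= norm1 f + norm1 g.
Proof.
by rewrite /norm1 -ExD; apply: le_Ex => // x; rewrite ffunE ler_normD.
Qed.

Lemma ler_norm1B f g : norm1 (f - g) <= norm1 f + norm1 g.
Proof.
by rewrite -[norm1 g]mul1r -(normrN1 R) -norm1Z scaleN1r ler_norm1D.
Qed.

Lemma ler_norm1_sum (I : finType) (P : pred I) (F : I -> V) :
  norm1 (\sum_(i | P i) F i) <= \sum_(i | P i) norm1 (F i).
Proof.
elim/big_ind2: _ => [|f x g y fx gy|//].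
  by rewrite -(scale0r 0) norm1Z normr0 mul0r.
exact: le_trans (ler_norm1D _ _) (lerD fx gy).
Qed.

End InnerProduct.

(** * Conditional expectation as an orthogonal projection *)

Section ConditionalExpectation.
Context {R : realType} {T : finType} (nu : T -> R).
Hypothesis nu_gt0 : forall x, 0 < nu x.
Hypothesis nu_pmf : is_pmf nu.
Context {TW : eqType} (W : T -> TW).
Local Notation V := {ffun T -> R^o}.
Implicit Types (f g h : V) (c : R).
Local Notation fiber x := [pred y | W y == W x].

Definition condE f : V := [ffun x => cEx nu f (fiber x)].

Lemma Pr_gt0 (A : pred T) x : A x -> 0 < Pr nu A.
Proof.
move=> Ax; rewrite /Pr (bigD1 x) //= ltr_pwDl // sumr_ge0 // => y _.
exact: ltW.
Qed.

Lemma Pr_fiber_gt0 x : 0 < Pr nu (fiber x).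
Proof. by apply: (@Pr_gt0 _ x) => /=. Qed.

Lemma condE_is_linear : linear condE.
Proof.
move=> c f g; apply/ffunP => x; rewrite !ffunE /cEx /GRing.scale /=.
rewrite mulrA -mulrDl mulr_sumr -big_split /=; congr (_ / _).
by apply: eq_bigr => y _; rewrite !ffunE /GRing.scale /=; ring.
Qed.
HB.instance Definition _ :=
  GRing.isLinear.Build R V V *:%R condE condE_is_linear.

Lemma condEB f g : condE (f - g) = condE f - condE g.
Proof. exact: raddfB. Qed.

Lemma condE_id f : (forall x y, W x = W y -> f x = f y) -> condE f = f.
Proof.
move=> fW; apply/ffunP => x; rewrite ffunE /cEx.
have -> : \sum_(y | W y == W x) nu y * f y = Pr nu (fiber x) * f x.
  by rewrite /Pr mulr_suml; apply: eq_bigr => y /eqP/fW ->.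
by rewrite mulrC mulKf // lt0r_neq0 // Pr_fiber_gt0.
Qed.

Lemma condE_const f x y : W x = W y -> condE f x = condE f y.
Proof. by move=> Wxy; rewrite !ffunE /= Wxy. Qed.

Lemma condE_idem f : condE (condE f) = condE f.
Proof. by apply: condE_id => x y; exact: condE_const. Qed.

(** Both sides expand to a double sum over pairs in the same fiber, with the symmetric weight
    [nu x * nu y] divided by the mass of the fiber. *)
Lemma dot_condE f g : dot nu (condE f) g = dot nu f (condE g).
Proof.
have H h k : dot nu (condE h) k = \sum_x \sum_(y | W y == W x)
    nu x * nu y * (h y * k x) / Pr nu (fiber x).
  apply: eq_bigr => x _; rewrite ffunE /cEx !mulr_suml mulr_sumr.
  by apply: eq_bigr => y _; ring.
rewrite [RHS]dotC !H [RHS](exchange_big_dep predT) //=.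
apply: eq_bigr => x _; apply: eq_big => [y|y /eqP ->]; first by rewrite eq_sym.
by congr (_ / _); ring.
Qed.

Lemma Ex_condE f : Ex nu (condE f) = Ex nu f.
Proof.
have E1 g : Ex nu g = dot nu g [ffun=> 1].
  by apply: eq_Ex => x; rewrite ffunE mulr1.
by rewrite !E1 dot_condE condE_id // => x y _; rewrite !ffunE.
Qed.

Lemma normr_condE f x : `|condE f x| <= condE [ffun y => `|f y|] x.
Proof.
rewrite !ffunE /cEx normrM normfV [`|Pr nu _|]gtr0_norm ?Pr_fiber_gt0 //.
rewrite ler_pM2r ?invr_gt0 ?Pr_fiber_gt0 //.
apply: le_trans (ler_norm_sum _ _ _) _; apply: ler_sum => y _.
by rewrite ffunE normrM gtr0_norm.
Qed.

Lemma norm1_condE f : norm1 nu (condE f) <= norm1 nu f.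
Proof.
apply: le_trans (le_Ex nu_pmf (normr_condE f)) _; rewrite Ex_condE.
by rewrite le_eqVlt; apply/orP; left; apply/eqP/eq_Ex => x; rewrite ffunE.
Qed.

Definition condD f : V := f - condE f.

Lemma condD_is_linear : linear condD.
Proof.
by move=> c f g; rewrite /condD linearP scalerBr addrACA -opprD.
Qed.
HB.instance Definition _ :=
  GRing.isLinear.Build R V V *:%R condD condD_is_linear.

Lemma condD_idem f : condD (condD f) = condD f.
Proof. by rewrite {1}/condD /condD condEB condE_idem subrr subr0. Qed.

Lemma dot_condD f g : dot nu (condD f) g = dot nu f (condD g).
Proof. by rewrite dotBl dotBr dot_condE. Qed.

Lemma norm2_condD f : norm2 nu (condD f) = dot nu f (condD f).
Proof. by rewrite norm2E dot_condD condD_idem. Qed.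

Lemma norm2_condDE f : norm2 nu (condD f) = norm2 nu f - norm2 nu (condE f).
Proof. by rewrite norm2_condD dotBr -norm2E -{1}condE_idem -dot_condE. Qed.

Lemma norm2_condD_le f : norm2 nu (condD f) <= norm2 nu f.
Proof. by rewrite norm2_condDE lerBlDr lerDl norm2_ge0. Qed.

Lemma norm1_condD f : norm1 nu (condD f) <= 2 * norm1 nu f.
Proof.
apply: le_trans (ler_norm1B nu_pmf _ _) _.
by rewrite mulr_natl mulr2n lerD2l norm1_condE.
Qed.

(** By Pythagoras: passing to [|f|] keeps the norm of [f] and can only increase that of its
    projection, as [|condE f| <= condE |f|]. *)
Lemma norm2_condD_norm f :
  norm2 nu (condD [ffun x => `|f x|]) <= norm2 nu (condD f).
Proof.
rewrite !norm2_condDE; apply: lerB.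
  by apply: le_Ex => // x; rewrite ffunE real_normK ?num_real.
apply: le_Ex => // x; rewrite -(real_normK (num_real (condE f x))).
by rewrite lerXn2r ?nnegrE // (le_trans _ (normr_condE f x)) ?normr_condE.
Qed.

Lemma condD_shift f c : condD (f + [ffun=> c]) = condD f.
Proof.
rewrite raddfD /= {2}/condD condE_id ?subrr ?addr0 // => x y _.
by rewrite !ffunE.
Qed.

End ConditionalExpectation.

(** * Discrete dynamics averaging a family of conditional expectations *)

Section Dynamics.
Context {R : realType} {T : finType} (nu : T -> R).
Context {I : finType} {TW : I -> eqType} (W : forall i, T -> TW i).
Local Notation V := {ffun T -> R^o}.
Implicit Types (f g h : V) (c : R).
Local Notation P i := (condE nu (W i)).
Local Notation D i := (condD nu (W i)).

Definition energy f : R := \sum_i norm2 nu (D i f).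
Definition lap f : V := \sum_i D i f.
Definition step f : V := f - (#|I|%:R^-1 : R) *: lap f.

Hypothesis nu_gt0 : forall x, 0 < nu x.
Hypothesis nu_pmf : is_pmf nu.
Hypothesis I_gt0 : (0 < #|I|)%N.
Local Notation eta := (#|I|%:R^-1 : R).

Let eta_gt0 : 0 < eta. Proof. by rewrite invr_gt0 ltr0n. Qed.
Let etaK : eta * #|I|%:R = 1. Proof. by rewrite mulVf // pnatr_eq0 -lt0n. Qed.

Lemma energy_ge0 f : 0 <= energy f.
Proof. by apply: sumr_ge0 => i _; exact: norm2_ge0. Qed.

Lemma energy_le_norm2 f : energy f <= #|I|%:R * norm2 nu f.
Proof.
rewrite mulr_natl -sumr_const.
by apply: ler_sum => i _; exact: norm2_condD_le.
Qed.

Lemma energy_norm f : energy [ffun x => `|f x|] <= energy f.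
Proof. by apply: ler_sum => i _; exact: norm2_condD_norm. Qed.

Lemma energy_shift f c : energy (f + [ffun=> c]) = energy f.
Proof. by apply: eq_bigr => i _; rewrite condD_shift. Qed.

Lemma lap_is_linear : linear lap.
Proof.
move=> c f g; rewrite /lap scaler_sumr -big_split; apply: eq_bigr => i _.
exact: linearP.
Qed.
HB.instance Definition _ := GRing.isLinear.Build R V V *:%R lap lap_is_linear.

Lemma dot_lap f : dot nu f (lap f) = energy f.
Proof. by rewrite dot_sumr; apply: eq_bigr => i _; rewrite norm2_condD. Qed.

Lemma dot_lapC f g : dot nu (lap f) g = dot nu f (lap g).
Proof.
by rewrite dot_suml dot_sumr; apply: eq_bigr => i _; rewrite dot_condD.
Qed.

(** As an average of conditional expectations, [step] visibly preserves the mean and contracts the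
    L1 norm; the form through [lap] suits energy computations. *)
Lemma stepE f : step f = eta *: \sum_i P i f.
Proof.
have -> : \sum_i P i f = #|I|%:R *: f - lap f.
  rewrite scaler_nat -sumr_const -sumrB; apply: eq_bigr => i _.
  by rewrite /condD opprB addrC subrK.
by rewrite scalerBr scalerA etaK scale1r.
Qed.

Lemma Ex_step f : Ex nu (step f) = Ex nu f.
Proof.
have E1 g : Ex nu g = dot nu [ffun=> 1] g.
  by apply: eq_Ex => x; rewrite ffunE mul1r.
rewrite E1 stepE dotZr dot_sumr.
under eq_bigr do rewrite -E1 Ex_condE //.
by rewrite sumr_const -[Ex _ _ *+ _]mulr_natl mulrA etaK mul1r.
Qed.

Lemma norm1_step f : norm1 nu (step f) <= norm1 nu f.
Proof.
rewrite stepE norm1Z gtr0_norm // ler_pdivrMl ?ltr0n // mulr_natl -sumr_const.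
apply: le_trans (ler_norm1_sum nu_pmf _ _) _.
by apply: ler_sum => i _; exact: norm1_condE.
Qed.

(** Expand the square and drop the nonnegative second-order term. *)
Lemma norm2_step f : norm2 nu f - norm2 nu (step f) <= 2 * eta * energy f.
Proof.
rewrite /step norm2B norm2Z dotZr dot_lap.
have : 0 <= eta ^+ 2 * norm2 nu (lap f) by rewrite mulr_ge0 ?sqr_ge0 ?norm2_ge0.
by move: (_ * norm2 _ _) => X; lra.
Qed.

(** The first-order term is [- 2 * eta * norm2 nu (lap f)]. By [energy_le_norm2] the second-order
    term [eta ^+ 2 * energy (lap f)] cancels at most half of it. *)
Lemma energy_step f : energy (step f) <= energy f - eta * norm2 nu (lap f).
Proof.
have lapB : lap (step f) = lap f - eta *: lap (lap f).
  by rewrite /step raddfB; congr (_ - _); exact: linearZ.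
rewrite -!dot_lap lapB /step !(dotBl, dotBr, dotZl, dotZr).
rewrite -[dot nu f (lap (lap f))]dot_lapC -norm2E !dot_lap.
have : eta ^+ 2 * energy (lap f) <= eta * norm2 nu (lap f).
  rewrite expr2 -mulrA ler_pM2l // ler_pdivrMl ?ltr0n //.
  exact: energy_le_norm2.
by move: (energy (lap f)) (norm2 _ _) (energy f) => X Y Z; lra.
Qed.

(** * Bounded degree: projections that commute off the edges of a graph *)

Section BoundedDegree.
Context (e : rel I) (Delta : nat).
Hypothesis e_sym : symmetric e.
Hypothesis e_deg : forall i, (#|neighbors e i| <= Delta)%N.
Hypothesis condE_comm : forall i j f, i != j -> ~~ e i j ->
  P i (P j f) = P j (P i f).

Lemma condD_comm i j f : ~~ e i j -> D i (D j f) = D j (D i f).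
Proof.
have [->//|ij] := eqVneq i j => eij.
rewrite /condD !condEB condE_comm // !opprB addrACA [RHS]addrACA.
by congr (_ + _); exact: addrC.
Qed.

Lemma sum_neighbors_le (F : I -> R) : (forall i, 0 <= F i) ->
  \sum_i \sum_(j | e i j) F i <= Delta%:R * \sum_i F i.
Proof.
move=> F0; rewrite mulr_sumr; apply: ler_sum => i _.
rewrite sumr_const -[_ *+ _]mulr_natl ler_wpM2r // ler_nat.
by apply: leq_trans (e_deg i); rewrite cardsE.
Qed.

(* For [i] not adjacent to [j] the projections [D i] and [D j] commute, so that
   [norm2 (D j (D i f)) = dot (D i f) (D j f)]. *)
Lemma sum_norm2_condD2 f :
  \sum_i energy (D i f) <= norm2 nu (lap f) + 2 * Delta%:R * energy f.
Proof.
pose x i := norm2 nu (D i f).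
(* On an edge, the left side is at most [x i], while [norm2 nu (D i f + D j f) >= 0] gives
   [dot >= - (x i + x j) / 2]; hence the weights 3/2 and 1/2. *)
have key i j : norm2 nu (D j (D i f)) <=
    dot nu (D i f) (D j f) + (if e i j then 3 / 2 * x i + 1 / 2 * x j else 0).
  case: ifPn => eij.
    have := norm2_condD_le nu_gt0 nu_pmf (W j) (D i f).
    have := norm2_ge0 nu_pmf (D i f + D j f); rewrite norm2D -/(x i) -/(x j).
    by move: (norm2 _ _) (dot _ _ _) => X Y; lra.
  by rewrite addr0 norm2_condD // -condD_comm // -dot_condD condD_idem.
apply: (@le_trans _ _ (\sum_i \sum_j (dot nu (D i f) (D j f) +
    (if e i j then 3 / 2 * x i + 1 / 2 * x j else 0)))).
  by apply: ler_sum => i _; apply: ler_sum => j _; exact: key.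
have -> : norm2 nu (lap f) = \sum_i \sum_j dot nu (D i f) (D j f).
  by rewrite norm2E dot_suml; apply: eq_bigr => i _; rewrite dot_sumr.
under eq_bigr do rewrite big_split.
rewrite big_split lerD2l /=.
have x0 i : 0 <= x i by exact: norm2_ge0.
have S1 := sum_neighbors_le x0.
have S2 : \sum_i \sum_(j | e i j) x j = \sum_i \sum_(j | e i j) x i.
  rewrite (exchange_big_dep predT) //=; apply: eq_bigr => j _.
  by apply: eq_bigl => i; rewrite e_sym.
have -> : \sum_i \sum_j (if e i j then 3 / 2 * x i + 1 / 2 * x j else 0) =
    3 / 2 * (\sum_i \sum_(j | e i j) x i) +
    1 / 2 * (\sum_i \sum_(j | e i j) x j).
  rewrite !mulr_sumr -big_split; apply: eq_bigr => i _ /=.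
  by rewrite -big_mkcond /= big_split /= !mulr_sumr.
rewrite S2; move: S1; rewrite -/(energy f).
by move: (\sum_i \sum_(j | _) _) => X; lra.
Qed.

(** Commuting [D i] past [step] leaves [eta] times the commutators of [D i] with its neighbors
    [D j]. The step contracts L1, and each of the at most [Delta] commutators has L1 norm at most
    [4 * B], as [condD] at most doubles L1 norms. *)
Lemma norm1_condD_step f B : (forall i, norm1 nu (D i f) <= B) ->
  forall i, norm1 nu (D i (step f)) <= (1 + 4 * eta * Delta%:R) * B.
Proof.
move=> fB i.
have -> : D i (step f) =
    step (D i f) + eta *: \sum_(j | e i j) (D j (D i f) - D i (D j f)).
  have -> : \sum_(j | e i j) (D j (D i f) - D i (D j f)) =
      lap (D i f) - D i (lap f).
    have -> : D i (lap f) = \sum_j D i (D j f) by exact: raddf_sum.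
    rewrite -sumrB [RHS](bigID (e i)) /= [X in _ + X]big1 ?addr0 //.
    by move=> j eij; rewrite (@condD_comm i j) ?subrr.
  have -> : D i (step f) = D i f - eta *: D i (lap f).
    by rewrite /step raddfB; congr (_ - _); exact: linearZ.
  by rewrite /step [_ *: (lap _ - _)]scalerBr addrA subrK.
apply: le_trans (ler_norm1D nu_pmf _ _) _; rewrite norm1Z gtr0_norm //.
rewrite mulrDl mul1r; apply: lerD; first exact: le_trans (norm1_step _) (fB i).
have -> : 4 * eta * Delta%:R * B = eta * (Delta%:R * (4 * B)) by ring.
rewrite ler_pM2l //.
have B0 : 0 <= B by apply: le_trans (fB i); exact: norm1_ge0.
apply: le_trans (ler_norm1_sum nu_pmf _ _) _.
apply: (@le_trans _ _ (\sum_(j | e i j) 4 * B)).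
  apply: ler_sum => j _; apply: le_trans (ler_norm1B nu_pmf _ _) _.
  have := norm1_condD nu_gt0 nu_pmf (W j) (D i f).
  have := norm1_condD nu_gt0 nu_pmf (W i) (D j f).
  have := fB i; have := fB j; lra.
rewrite sumr_const -[_ *+ _]mulr_natl.
by rewrite ler_wpM2r ?mulr_ge0 // ler_nat (leq_trans _ (e_deg i)) // cardsE.
Qed.

Lemma norm1_condD_iter f B k : (forall i, norm1 nu (D i f) <= B) ->
  forall i, norm1 nu (D i (iter k step f)) <= (1 + 4 * eta * Delta%:R) ^+ k * B.
Proof.
move=> fB; elim: k => [|k IHk] i; first by rewrite mul1r.
by rewrite iterS exprS -mulrA; exact: norm1_condD_step.
Qed.

(** * Energy decay under the log-Sobolev inequality *)

Section LogSobolev.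
Context (rho : R).
Hypothesis rho_gt0 : 0 < rho.
Hypothesis lsi : forall h,
  rho * Ent nu (fun x => h x ^+ 2) <= 2 * energy [ffun x => `|h x|].

Lemma Ent_sq_le_energy h : rho * Ent nu (fun x => h x ^+ 2) <= 2 * energy h.
Proof. by apply: le_trans (lsi h) _; rewrite ler_pM2l // energy_norm. Qed.

(* The energy does not see an additive constant, which makes [f] nonnegative. *)
Lemma poincare f : rho * Var nu f <= 2 * energy f.
Proof.
pose c := \sum_x `|f x|.
have fc x : 0 <= f x + c.
  have : `|f x| <= c by rewrite /c (bigD1 x) //= lerDl sumr_ge0.
  by have := ler_norm (- f x); rewrite normrN; lra.
rewrite -(Var_shift nu_pmf f c) -(energy_shift f c).
apply: le_trans (Ent_sq_le_energy _); rewrite ler_pM2l //.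
apply: le_trans (Var_norm_le_Ent_sq nu_pmf _).
rewrite le_eqVlt; apply/orP; left; apply/eqP.
have E : (fun x => f x + c) =1 (fun x => `|(f + [ffun=> c]) x|).
  by move=> x; rewrite !ffunE ger0_norm.
by rewrite !VarE // (eq_Ex _ E); congr (_ - _); apply: eq_Ex => x; rewrite E.
Qed.

(** Apply log-Sobolev and [Ent_sq_ge_linear] to each [D i f] and sum over [i]. Together with
    [sum_norm2_condD2] this bounds [norm2 nu (lap f)], the dissipation in [energy_step], from
    below. *)
Lemma energy_step_decay f s l : 1 <= s -> (forall i, norm1 nu (D i f) <= l) ->
  energy (step f) <= energy f
    - eta * ((rho * ln s - 2 * Delta%:R) * energy f
             - rho * ln s * (s ^+ 2 * (#|I|%:R * l ^+ 2))).
Proof.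
move=> s1 fl; apply: le_trans (energy_step f) _.
rewrite lerD2l lerN2 ler_pM2l //.
have H i : rho * (2 * ln s * (norm2 nu (D i f) - s ^+ 2 * l ^+ 2))
    <= 2 * energy (D i f).
  apply: le_trans (Ent_sq_le_energy _); rewrite ler_pM2l //.
  exact: (Ent_sq_ge_linear nu_pmf s1 (fl i)).
have : \sum_i rho * (2 * ln s * (norm2 nu (D i f) - s ^+ 2 * l ^+ 2))
    <= \sum_i 2 * energy (D i f) by apply: ler_sum => i _; exact: H.
rewrite -!mulr_sumr sumrB -/(energy f).
rewrite sumr_const -[_ ^+ 2 * _ *+ _]mulr_natl.
have := sum_norm2_condD2 f.
move: (\sum_i energy _) (energy f) (norm2 _ _) (ln s) => X Y Z L.
have -> : s ^+ 2 * (#|I|%:R * l ^+ 2) = #|I|%:R * (s ^+ 2 * l ^+ 2) by ring.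
by move: (#|I|%:R * _) => U; lra.
Qed.

Lemma energy_iter_decreasing f j k : (j <= k)%N ->
  energy (iter k step f) <= energy (iter j step f).
Proof.
move=> /subnK <-; elim: (k - j)%N => [//|m IH]; apply: le_trans IH.
rewrite addSn iterS; apply: le_trans (energy_step _) _.
by rewrite gerBl mulr_ge0 ?norm2_ge0 // ltW.
Qed.

Lemma norm2_iter f k : norm2 nu f <=
  norm2 nu (iter k step f) + 2 * eta * \sum_(j < k) energy (iter j step f).
Proof.
elim: k => [|k IHk]; first by rewrite big_ord0 mulr0 addr0.
apply: le_trans IHk _; rewrite big_ord_recr iterS /= mulrDr.
by have := norm2_step (iter k step f); lra.
Qed.

Lemma Ex_iter f k : Ex nu (iter k step f) = Ex nu f.
Proof. by elim: k => [//|k IHk]; rewrite iterS Ex_step. Qed.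

(* [#|I|] steps amount to one unit of continuous time. *)
Lemma Var_le_average_energy f :
  rho * Var nu f <= (2 * rho + 2) *
    (eta * \sum_(j < #|I|) energy (iter j step f)).
Proof.
set N := #|I|; set S := _ * \sum_(_ < _) _.
have V1 : Var nu f <= Var nu (iter N step f) + 2 * S.
  rewrite !VarE // Ex_iter; have := norm2_iter f N.
  by rewrite -[2 * _ * _]mulrA -/S /norm2; lra.
(* The energy decreases along the dynamics, so its final value is at most its average; Poincare then
   bounds the remaining variance by [S]. *)
have E1 : energy (iter N step f) <= S.
  rewrite /S ler_pdivlMl ?ltr0n // mulr_natl.
  rewrite -[in leLHS](card_ord N) -sumr_const.
  apply: ler_sum => j _; rewrite card_ord.
  exact: energy_iter_decreasing (ltnW (ltn_ord j)).
have := poincare (iter N step f).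
have : rho * Var nu f <= rho * (Var nu (iter N step f) + 2 * S).
  by rewrite ler_pM2l.
by lra.
Qed.

(** Sum [energy_step_decay] over [#|I|] steps and drop the final energy. Along the way the L1 norms
    grow by at most the factor [expR (4 * Delta)]. *)
Lemma average_energy_le f s l : 1 <= s -> 0 <= rho * ln s - 2 * Delta%:R ->
  (forall i, norm1 nu (D i f) <= l) ->
  (rho * ln s - 2 * Delta%:R) *
    (eta * \sum_(j < #|I|) energy (iter j step f))
  <= energy f + rho * ln s *
       (s ^+ 2 * (#|I|%:R * (expR (4 * Delta%:R) * l) ^+ 2)).
Proof.
move=> s1 kappa0 fl; set kappa := _ - _ in kappa0 *.
set l' := expR _ * l; set eps := rho * ln s * _.
have [i0 _] : exists i : I, true by case/card_gt0P: I_gt0 => i _; exists i.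
have l0 : 0 <= l by apply: le_trans (fl i0); exact: norm1_ge0.
(* The restriction on [k] is what keeps the L1 norms below [l']. *)
have H k : (k <= #|I|)%N ->
    energy (iter k step f) + kappa * (eta * \sum_(j < k) energy (iter j step f))
    <= energy f + k%:R * eta * eps.
  elim: k => [|k IHk] kI; first by rewrite big_ord0 !(mulr0, mul0r).
  have := IHk (ltnW kI); rewrite big_ord_recr iterS /=.
  have : forall i, norm1 nu (D i (iter k step f)) <= l'.
    move=> i; apply: le_trans (norm1_condD_iter _ fl i) _.
    rewrite ler_wpM2r // [4 * _ * _]mulrAC mulrC.
    rewrite expr_1Ddiv_le_expR ?mulr_ge0 //.
    exact: ltnW.
  move=> /(energy_step_decay s1); rewrite -/kappa -/eps -natr1.
  move: (energy (step _)) (energy (iter _ _ _)) (\sum_(j < k) _) => X Y Z.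
  by move: eta => t; lra.
have := H #|I| (leqnn _); rewrite [_ * eta]mulrC etaK mul1r.
by have := energy_ge0 (iter #|I| step f); lra.
Qed.

End LogSobolev.
End BoundedDegree.
End Dynamics.

(** * Configurations and single-coordinate updates *)

Section Configurations.
Context {n : nat} {Sigma : finType}.
Implicit Types (x y : {ffun 'I_n -> Sigma}) (i j : 'I_n) (A : {set 'I_n}).

Lemma restrP A x y :
  reflect (forall j, j \in A -> x j = y j) (restr A x == restr A y).
Proof.
apply: (iffP eqP) => [/ffunP xy j jA|xy].
  by have := xy (exist _ j jA); rewrite !ffunE.
by apply/ffunP => -[j jA]; rewrite !ffunE; exact: xy.
Qed.

Lemma restr_update A x i a : i \notin A -> restr A (update x i a) = restr A x.
Proof.
move=> iA; apply/eqP/restrP => j jA; rewrite ffunE ifN //.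
by apply: contraNneq iA => <-.
Qed.

Lemma restrC1P i x y :
  reflect (y = update x i (y i)) (restr [set~ i] y == restr [set~ i] x).
Proof.
apply: (iffP (restrP _ _ _)) => [yx|-> j]; last first.
  by rewrite !inE => /negPf ji; rewrite ffunE ji.
apply/ffunP => j; rewrite ffunE; case: eqVneq => [->//|ji].
by apply: yx; rewrite !inE.
Qed.

Lemma update_same x i a : update x i a i = a.
Proof. by rewrite ffunE eqxx. Qed.

Lemma updateC x i j a c : i != j ->
  update (update x i a) j c = update (update x j c) i a.
Proof.
move=> ij; apply/ffunP => k; rewrite !ffunE.
by case: eqVneq => [->|//]; rewrite eq_sym (negPf ij).
Qed.

Lemma sum_restrC1 {R : realType} i x (F : {ffun 'I_n -> Sigma} -> R) :
  \sum_(y | restr [set~ i] y == restr [set~ i] x) F y =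
  \sum_a F (update x i a).
Proof.
rewrite (reindex_onto (update x i) (fun y => y i)) => [|y /restrC1P <-//].
apply: eq_bigl => a; rewrite update_same eqxx andbT.
by apply/restrC1P; rewrite update_same.
Qed.

Lemma hamming_update x i a : a != x i -> hamming x (update x i a) = 1%N.
Proof.
move=> ax; rewrite /hamming -(cards1 i); congr #|pred_of_set _|.
apply/setP => j; rewrite !inE ffunE.
have [->|_] := eqVneq j i; last by rewrite eqxx.
by rewrite eq_sym.
Qed.

End Configurations.

(** * Glauber dynamics as an instance of the abstract dynamics *)

Section GlauberDynamics.
Context {R : realType} {n : nat} {Sigma : finType}.
Context (nu : {ffun 'I_n -> Sigma} -> R).
Local Notation V := {ffun {ffun 'I_n -> Sigma} -> R^o}.
Implicit Types (x y : {ffun 'I_n -> Sigma}) (i j : 'I_n).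
Local Notation W := (fun i => @restr n Sigma [set~ i]).

(** A zero of [nu] would have ratio 0 (even over 0) to a configuration differing at the first
    coordinate, below [b^-1]. If no other symbol exists there, [Sigma] is a singleton, so [x] is the
    only configuration and has mass 1. *)
Lemma bounded_ratios_gt0 b x : (1 <= n)%N -> 0 < b -> is_pmf nu ->
  bounded_ratios nu b -> 0 < nu x.
Proof.
case: n nu x => [//|m] mu x _ b0 [mu0 mu1] mub.
rewrite lt_def mu0 andbT; apply/eqP => mux0.
have [/existsP[a ax]|/existsPn all_eq] := boolP [exists a, a != x ord0].
  have := mub x _ (hamming_update ax).
  by rewrite mux0 mul0r leNgt invr_gt0 b0.
have /eqP := mu1; rewrite big1 ?(eq_sym 0) ?oner_eq0 // => y _.
suff -> : y = x by [].
apply/ffunP => j.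
have /negPn/eqP -> := all_eq (y j).
by have /negPn/eqP -> := all_eq (x j).
Qed.

Lemma glauberLE i (g : V) x : glauberL nu i g x = - condD nu (W i) g x.
Proof. by rewrite /glauberL /condD !ffunE opprB. Qed.

Lemma dirichletE (g : V) : dirichlet nu g = energy nu W g.
Proof.
by apply: eq_bigr => i _; apply: eq_Ex => x; rewrite glauberLE sqrrN.
Qed.

Hypothesis nu_gt0 : forall x, 0 < nu x.

Definition spin_law (N : {set 'I_n}) i (a : Sigma) x : R :=
  cPr nu [pred y : {ffun 'I_n -> Sigma} | y i == a]
    [pred y | restr N y == restr N x].

Section MarkovRandomField.
Context (e : rel 'I_n).
Hypothesis e_graph : simple_graph e.
Hypothesis nu_mrf : markov_random_field nu e.

(** The Markov property is applied to the values [a], [restr M x] and [restr N x]; the joint event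
    then isolates [update x i a], and the mass of the neighborhood event cancels. *)
Lemma mrf_update i a x :
  nu (update x i a) = spin_law (neighbors e i) i a x *
    Pr nu [pred y | restr [set~ i] y == restr [set~ i] x].
Proof.
set N := neighbors e i; set M := ~: (i |: N).
have iN : i \notin N by rewrite inE e_graph.2.
(* Since [i] is not its own neighbor, [M] and [N] together cover exactly the coordinates other than
   [i]. *)
have split_restr y z : (restr M y == restr M z) && (restr N y == restr N z) =
    (restr [set~ i] y == restr [set~ i] z).
  apply/andP/idP => [[/restrP yM /restrP yN]|/restrP yz].
    apply/restrP => j; rewrite !inE => ji.
    have [jN|jN] := boolP (j \in N); first exact: yN.
    by apply: yM; rewrite !inE negb_or ji; move: jN; rewrite inE.
  split; apply/restrP => j jA; apply: yz; rewrite !inE.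
    by move: jA; rewrite !inE negb_or => /andP[].
  by apply: contraNneq iN => <-.
have ZN : Pr nu [pred y | restr N y == restr N x] != 0.
  by rewrite lt0r_neq0 // (Pr_gt0 nu_gt0 (x := x)) //=.
have := @nu_mrf i a (restr M x) (restr N x).
rewrite -/N -/M -/(spin_law N i a x) /cPr.
have -> : Pr nu (predI [pred y : {ffun 'I_n -> Sigma} |
      (y i == a) && (restr M y == restr M x)]
    [pred y | restr N y == restr N x]) = nu (update x i a).
  rewrite /Pr (eq_bigl (pred1 (update x i a))) ?big_pred1_eq // => y /=.
  rewrite -andbA split_restr; apply/andP/eqP => [[/eqP <- /restrC1P <-//]|->].
  by rewrite update_same eqxx restr_update // !inE eqxx.
have -> : Pr nu (predI [pred y | restr M y == restr M x]
    [pred y | restr N y == restr N x]) =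
    Pr nu [pred y | restr [set~ i] y == restr [set~ i] x].
  by apply: eq_bigl => y /=; exact: split_restr.
move=> H; apply: (mulIf (invr_neq0 ZN)).
by rewrite H mulrA.
Qed.

Lemma condE_mrf i (g : V) x : condE nu (W i) g x =
  \sum_a spin_law (neighbors e i) i a x * g (update x i a).
Proof.
rewrite ffunE /cEx sum_restrC1 mulr_suml; apply: eq_bigr => a _.
rewrite mrf_update mulrAC mulfK // lt0r_neq0 //.
exact: Pr_fiber_gt0.
Qed.

Lemma spin_law_update (N : {set 'I_n}) i j a c x : j \notin N ->
  spin_law N i a (update x j c) = spin_law N i a x.
Proof. by move=> jN; rewrite /spin_law restr_update. Qed.

(** Resampling [i] uses a law that does not read coordinate [j], and conversely, so both orders give
    the same double sum over the two new spins. *)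
Lemma condE_restr_comm i j (g : V) : i != j -> ~~ e i j ->
  condE nu (W i) (condE nu (W j) g) = condE nu (W j) (condE nu (W i) g).
Proof.
move=> ij eij.
have iNj : i \notin neighbors e j by rewrite inE e_graph.1.
have jNi : j \notin neighbors e i by rewrite inE.
apply/ffunP => x; rewrite !condE_mrf.
under eq_bigr do rewrite condE_mrf mulr_sumr.
rewrite exchange_big; apply: eq_bigr => c _ /=.
rewrite condE_mrf mulr_sumr; apply: eq_bigr => a _.
by rewrite !spin_law_update // updateC // mulrCA.
Qed.

End MarkovRandomField.

Hypothesis nu_pmf : is_pmf nu.

(** * Boolean functions: influences dominate the norms of [condD] *)

Section BooleanFunction.
Context (f : {ffun 'I_n -> Sigma} -> bool).
Local Notation fR := ([ffun x => (f x)%:R] : V).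

Lemma condE_bool_itv i x : 0 <= condE nu (W i) fR x <= 1.
Proof.
rewrite ffunE /cEx; set Z := Pr _ _.
have Z0 : 0 < Z by exact: Pr_fiber_gt0.
rewrite divr_ge0 ?(ltW Z0) //=; last first.
  by apply: sumr_ge0 => y _; rewrite ffunE mulr_ge0 // ltW.
rewrite ler_pdivrMr // mul1r; apply: ler_sum => y _.
by rewrite ffunE ler_piMr ?lern1 ?leq_b1 // ltW.
Qed.

(** If no update at [i] changes [f], then [f] is constant on the fiber and the difference vanishes;
    otherwise it is a difference of two numbers in [0, 1]. *)
Lemma normr_condD_bool i x : `|condD nu (W i) fR x| <=
  [exists a, f x != f (update x i a)]%:R.
Proof.
have -> : condD nu (W i) fR x = (f x)%:R - condE nu (W i) fR x.
  by rewrite !ffunE.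
have [_|/existsPn H] := boolP [exists a, f x != f (update x i a)].
  have /andP[] := condE_bool_itv i x; rewrite ler_norml.
  by move: (f x) (condE _ _ _ _) => [] X /=; lra.
rewrite ffunE /cEx (eq_bigr (fun y => nu y * (f x)%:R)) => [|y /restrC1P ->].
  rewrite -mulr_suml mulrAC divff ?mul1r ?subrr ?normr0 //.
  by rewrite lt0r_neq0 // (Pr_fiber_gt0 nu_gt0).
by rewrite !ffunE; have /negPn/eqP <- := H (y i).
Qed.

Lemma influenceE i :
  influence nu i f = Ex nu (fun x => [exists a, f x != f (update x i a)]%:R).
Proof.
rewrite /influence /Pr big_mkcond; apply: eq_bigr => x _ /=.
by case: ifP; rewrite (mulr1, mulr0).
Qed.

Lemma influence_ge0 i : 0 <= influence nu i f.
Proof. by rewrite influenceE Ex_ge0. Qed.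

Lemma norm1_condD_influence i :
  norm1 nu (condD nu (W i) fR) <= influence nu i f.
Proof.
by rewrite influenceE; apply: le_Ex => // x; exact: normr_condD_bool.
Qed.

Lemma norm2_condD_influence i :
  norm2 nu (condD nu (W i) fR) <= influence nu i f.
Proof.
rewrite influenceE; apply: le_Ex => // x.
rewrite -real_normK ?num_real //; apply: le_trans (normr_condD_bool i x).
rewrite expr2 ler_piMl // (le_trans (normr_condD_bool i x)) //.
by rewrite lern1 leq_b1.
Qed.

End BooleanFunction.
End GlauberDynamics.

(* [S] is the average energy over the [N] steps. The choice [s = N^(1/4)] makes
   the error term lower order; if [rho * L <= 16 * Delta] the Poincare inequality
   alone suffices. *)
Lemma kkl_arithmetic {R : realType} (rho Delta C alpha V L S N : R) :
  0 < rho <= 1 -> 0 <= Delta -> 0 <= C -> 0 < V <= 1 -> 0 < L -> N = expR L ->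
  0 <= alpha -> 64 * (Delta + 1) * (1 + 4 * C) * alpha <= rho ^+ 2 ->
  rho * V <= 2 * (alpha * V * L) ->
  rho * V <= (2 * rho + 2) * S ->
  (forall s, 1 <= s -> 0 <= rho * ln s - 2 * Delta ->
    (rho * ln s - 2 * Delta) * S <= alpha * V * L +
      rho * ln s * (s ^+ 2 * (N * (C * (alpha * V * (L / N)) ^+ 2)))) ->
  False.
Proof.
move=> /andP[rho0 rho1] D0 C0 /andP[V0 V1] L0 NL a0 aC smallL VS HS.
(* The factor [(Delta + 1) * (1 + 4 * C)] dominates both [Delta], used when [L] is small, and
   [1 + 4 * C], used in the decay argument. *)
have aD : 64 * Delta * alpha <= rho ^+ 2.
  apply: le_trans aC; rewrite ler_wpM2r //.
  by rewrite -subr_ge0; have := mulr_ge0 D0 C0; lra.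
have aC' : 64 * (1 + 4 * C) * alpha <= rho ^+ 2.
  apply: le_trans aC; rewrite ler_wpM2r //.
  by rewrite -subr_ge0; have := mulr_ge0 D0 C0; lra.
have a1 : alpha <= 1.
  have : rho ^+ 2 <= 1 by rewrite expr_le1 // ltW.
  by have := mulr_ge0 C0 a0; lra.
(* In the first case Poincare gives [rho ^+ 2 * V <= 32 * Delta * alpha * V], at most half of
   [rho ^+ 2 * V]. *)
have [Lle|Lgt] := leP (rho * L) (16 * Delta).
  have : rho * (rho * V) <= rho * (2 * (alpha * V * L)) by rewrite ler_pM2l.
  have -> : rho * (2 * (alpha * V * L)) = 2 * alpha * V * (rho * L) by ring.
  have : 2 * alpha * V * (rho * L) <= 2 * alpha * V * (16 * Delta).
    by rewrite ler_wpM2l // !mulr_ge0 // ltW.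
  have : V * (64 * Delta * alpha) <= V * rho ^+ 2 by rewrite ler_pM2l.
  have : 0 < V * rho ^+ 2 by rewrite mulr_gt0 ?exprn_gt0.
  by lra.
pose s := expR (L / 4).
have Ns : N = s ^+ 4.
  by rewrite NL /s -expRM_natl; congr expR; field.
have s1 : 1 <= s by apply: le_trans (expR_ge1Dx _); lra.
have sL : L / 4 <= s by apply: le_trans (expR_ge1Dx _); lra.
have lns : ln s = L / 4 by rewrite /s expRK.
have s0 : 0 < s by exact: expR_gt0.
(* With [N = s ^+ 4] the powers of [s] and [L] collapse to [(L / s) ^+ 2], which is at most 16
   because [L / 4 <= s]. *)
have err : s ^+ 2 * (N * (C * (alpha * V * (L / N)) ^+ 2)) <=
    16 * (C * alpha * V).
  have -> : s ^+ 2 * (N * (C * (alpha * V * (L / N)) ^+ 2)) =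
      C * alpha * V * (alpha * V) * (L / s) ^+ 2.
    by rewrite Ns; field; exact: lt0r_neq0.
  have Ls : (L / s) ^+ 2 <= 16.
    have -> : 16 = 4 ^+ 2 :> R by ring.
    rewrite lerXn2r ?nnegrE ?divr_ge0 ?(ltW L0) ?(ltW s0) //.
    by rewrite ler_pdivrMr //; lra.
  have aV : alpha * V <= 1 by rewrite mulr_ile1 // ltW.
  rewrite [leRHS]mulrC; apply: ler_pM => //.
  - by rewrite !mulr_ge0 // ltW.
  - exact: sqr_ge0.
  - by rewrite ler_piMr // !mulr_ge0 // ltW.
have kappa0 : 0 <= rho * ln s - 2 * Delta by rewrite lns; lra.
have := HS s s1 kappa0; rewrite lns => {}HS.
have S0 : 0 <= S.
  by have : 0 < (2 * rho + 2) * S; [apply: lt_le_trans VS; rewrite mulr_gt0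
    | rewrite pmulr_rgt0 => [/ltW//|]; lra].
have rS : rho * S <= 8 * ((1 + 4 * C) * alpha) * V.
  rewrite -(ler_pM2l L0).
  (* Here [2 * Delta < rho * L / 8], so half of the rate [rho * L / 4] survives. *)
  have H1 : rho * L / 8 * S <= (rho * (L / 4) - 2 * Delta) * S.
    by rewrite ler_wpM2r //; lra.
  have H2 : rho * (L / 4) * (s ^+ 2 * (N * (C * (alpha * V * (L / N)) ^+ 2))) <=
      L / 4 * (16 * (C * alpha * V)).
    apply: le_trans (ler_wpM2l _ err) _.
      by rewrite mulr_ge0 ?divr_ge0 // ltW.
    rewrite ler_wpM2r ?mulr_ge0 ?(ltW V0) //.
    by rewrite ler_piMl // divr_ge0 // ltW.
  by lra.
(* Altogether [rho ^+ 2 * V <= 4 * rho * S <= 32 * (1 + 4 * C) * alpha * V], again at most half of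
   [rho ^+ 2 * V]. *)
have H3 : rho * (rho * V) <= (2 * rho + 2) * (rho * S).
  by rewrite [leRHS]mulrCA ler_pM2l.
have H4 : (2 * rho + 2) * (rho * S) <= 4 * (rho * S).
  by rewrite ler_wpM2r ?mulr_ge0 ?(ltW rho0) //; lra.
have H5 : V * (64 * (1 + 4 * C) * alpha) <= V * rho ^+ 2 by rewrite ler_pM2l.
have : 0 < V * rho ^+ 2 by rewrite mulr_gt0 ?exprn_gt0.
by lra.
Qed.

Theorem theorem2p3 (R : realType) (b rho : R) (Delta q : nat)
    (hb : 1 <= b) (hrho : 0 < rho <= 1) (hq : (1 <= q)%N) :
  exists2 alpha : R, 0 < alpha &
    forall (n : nat) (Sigma : finType) (nu : {ffun 'I_n -> Sigma} -> R)
        (e : rel 'I_n),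
      (1 <= n)%N -> #|Sigma| = q -> is_pmf nu ->
      bounded_ratios nu b ->
      log_sobolev nu rho ->
      simple_graph e -> max_degree e = Delta -> markov_random_field nu e ->
      forall f : {ffun 'I_n -> Sigma} -> bool,
        exists k : 'I_n,
          alpha * Var nu (fun x => (f x)%:R) * (ln n%:R / n%:R)
            <= influence nu k f.
Proof.
have /andP[rho0 _] := hrho.
(* [C] is the square of the growth factor of the L1 norms over [n] steps, and [M] the constant
   required by [kkl_arithmetic]. *)
pose C : R := expR (4 * Delta%:R) ^+ 2.
have C0 : 0 <= C by exact: sqr_ge0.
pose M : R := 64 * (Delta%:R + 1) * (1 + 4 * C).
have M0 : 0 < M by rewrite !mulr_gt0 //; have := ler0n R Delta; lra.
exists (rho ^+ 2 / M); first by rewrite divr_gt0 ?exprn_gt0.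
set alpha := _ / M; have alpha0 : 0 < alpha by rewrite divr_gt0 ?exprn_gt0.
have Malpha : M * alpha <= rho ^+ 2.
  by rewrite /alpha mulrCA divff ?mulr1 ?lt0r_neq0.
move=> n Sigma nu e n_gt0 _ nu_pmf nu_b nu_lsi e_graph e_deg nu_mrf f.
have nu_gt0 x : 0 < nu x.
  by apply: bounded_ratios_gt0 nu_b => //; exact: lt_le_trans ltr01 hb.
set V := Var nu _; set L : R := ln n%:R.
have N0 : 0 < n%:R :> R by rewrite ltr0n.
have V_ge0 : 0 <= V by exact: Var_ge0.
have L_ge0 : 0 <= L by rewrite ln_ge0 // ler1n.
set delta := alpha * V * (L / n%:R).
apply/existsP; apply: contraT => /existsPn small.
have {}small k : influence nu k f < delta by rewrite ltNge small.
(* Influences are nonnegative and strictly below [delta], which rules out the degenerate cases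
   [V = 0] and [L = 0]. *)
have delta0 : 0 < delta.
  exact: le_lt_trans (influence_ge0 nu_pmf f (Ordinal n_gt0)) (small _).
have V0 : 0 < V.
  rewrite lt_def V_ge0 andbT; apply: contraTneq delta0 => V0.
  by rewrite /delta V0 mulr0 mul0r ltxx.
have L0 : 0 < L.
  rewrite lt_def L_ge0 andbT; apply: contraTneq delta0 => L0.
  by rewrite /delta L0 mul0r mulr0 ltxx.
pose fR : {ffun {ffun 'I_n -> Sigma} -> R^o} := [ffun x => (f x)%:R].
have VE : Var nu fR = V.
  rewrite /V !VarE //; congr (_ - _ ^+ 2);
    by apply: eq_Ex => x; rewrite ffunE.
have V1 : V <= 1.
  rewrite -VE VarE // lerBlDr -[leLHS]addr0 lerD ?sqr_ge0 //.
  rewrite -(Ex_cst nu_pmf 1); apply: le_Ex => // x.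
  by rewrite ffunE; case: (f x); rewrite ?expr1n ?expr0n.
pose W i := @restr n Sigma [set~ i].
have I_gt0 : (0 < #|'I_n|)%N by rewrite card_ord.
(* Log-Sobolev for the function [h ^+ 2], whose square root is [|h|]. *)
have lsi (h : {ffun {ffun 'I_n -> Sigma} -> R^o}) :
    rho * Ent nu (fun x => h x ^+ 2) <= 2 * energy nu W [ffun x => `|h x|].
  rewrite -dirichletE; apply: le_trans (nu_lsi _ (fun x => sqr_ge0 (h x))) _.
  have -> // : dirichlet nu (fun x => Num.sqrt (h x ^+ 2)) =
    dirichlet nu [ffun x => `|h x|].
  by congr dirichlet; apply: boolp.funext => x; rewrite ffunE sqrtr_sqr.
have energy_fR : energy nu W fR <= alpha * V * L.
  have -> : alpha * V * L = n%:R * delta.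
    by rewrite /delta; field; exact: lt0r_neq0.
  rewrite mulr_natl -[n in leRHS]card_ord -sumr_const; apply: ler_sum => i _.
  exact: le_trans (norm2_condD_influence nu_gt0 nu_pmf f i) (ltW (small i)).
have deg i : (#|neighbors e i| <= Delta)%N by rewrite -e_deg; exact: leq_bigmax.
have comm i j g := @condE_restr_comm _ _ _ _ nu_gt0 _ e_graph nu_mrf i j g.
have norm1_fR i : norm1 nu (condD nu (W i) fR) <= delta.
  exact: le_trans (norm1_condD_influence nu_gt0 nu_pmf f i) (ltW (small i)).
suff : False by [].
apply: (@kkl_arithmetic R rho Delta%:R C alpha V L
  (n%:R^-1 * \sum_(j < n) energy nu W (iter j (step nu W) fR)) n%:R) => //.
- by rewrite V0.
- by rewrite /L lnK.
- exact: ltW.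
- have := poincare nu_gt0 nu_pmf rho0 lsi fR.
  by rewrite VE => /le_trans; apply; rewrite ler_pM2l.
- have := Var_le_average_energy nu_gt0 nu_pmf I_gt0 rho0 lsi fR.
  by rewrite VE card_ord.
- move=> s s1 kappa0.
  have := average_energy_le nu_gt0 nu_pmf I_gt0 e_graph.1 deg comm rho0 lsi s1
    kappa0 norm1_fR.
  rewrite card_ord exprMn -/C => H; apply: le_trans H _.
  by rewrite lerD2r.
Qed.
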